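(* There exists an absolute constant $c>0$ such that the following holds. Let $P$ be an irreducible and reversible transition matrix on a finite state space $V$ with invariant distribution $\pi$ and relaxation time $t_{\mathrm{rel}}$. For all $\lambda\in[0,1]$ with $0\le\lambda\le 1/t_{\mathrm{rel}}$ and all $x,y\in V$ with $x\ne y$, $$c\,\mathcal{R}_0(x,y)\le \mathcal{R}_\lambda(x,y)\le \frac{1}{1-\lambda}\cdot\mathcal{R}_0(x,y),$$ where for $\lambda=1$ the right-hand side is interpreted as $+\infty$.
   Context: Reversible means $\pi(x)P(x,y)=\pi(y)P(y,x)$ for all $x,y$. The relaxation time is $t_{\mathrm{rel}}=1/\gamma$ with $\gamma=1-\max\{\lambda:\lambda\text{ is an eigenvalue of }P,\ \lambda\ne1\}$. For $\lambda\in[0,1]$ let $K_\lambda$ be the transition matrix on $V$ given by $K_\lambda(x,y)=(1-\lambda)P(x,y)+\lambda\pi(y)$. It is reversible with respect to $\pi$ and is the weighted random walk on $V$ with edge weights (conductances) $$w_\lambda(x,y)=(1-\lambda)\pi(x)P(x,y)+\lambda\pi(x)\pi(y),$$ so that $w_\lambda(x)=\sum_y w_\lambda(x,y)=\pi(x)$. $\mathcal{R}_\lambda(x,y)$ denotes the effective resistance between $x$ and $y$ in the weighted graph $(V,w_\lambda)$; equivalently, for $x\neq y$, $$\mathcal{R}_\lambda(x,y)=\frac{1}{\pi(x)\,\mathbb{P}_{x,\lambda}(\tau_y<\tau_x^+)},$$ where $\mathbb{P}_{x,\lambda}$ is the law of the chain with matrix $K_\lambda$ started at $x$, $\tau_y=\min\{t\ge0:X_t=y\}$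 and $\tau_x^+=\min\{t\ge1:X_t=x\}$. *)

(* Defs.v *)
From mathcomp Require Import all_boot all_order all_algebra.
From mathcomp Require Import all_classical all_reals.

Set Implicit Arguments.
Unset Strict Implicit.
Unset Printing Implicit Defensive.

Import Order.TTheory GRing.Theory Num.Theory.
Local Open Scope classical_set_scope.
Local Open Scope ring_scope.

Section MarkovChain.
Context {R : realType} {V : finType}.
Implicit Types (P : V -> V -> R) (pi : V -> R).

Definition transition_matrix P : Prop :=
  (forall x y, 0 <= P x y) /\ (forall x, \sum_y P x y = 1).

(* P as a matrix indexed by the canonical enumeration of V *)
Definition mx_of P : 'M[R]_#|V| :=
  \matrix_(i, j) P (enum_val i) (enum_val j).

Definition irreducible P : Prop :=
  forall x y, exists t : nat,
    0 < (mx_of P ^+ t) (enum_rank x) (enum_rank y).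

Definition invariant_distribution P pi : Prop :=
  [/\ forall x, 0 <= pi x, \sum_x pi x = 1 &
      forall y, \sum_x pi x * P x y = pi y].

Definition reversible P pi : Prop :=
  forall x y, pi x * P x y = pi y * P y x.

(* For P irreducible and reversible all eigenvalues are real, and for
   #|V| >= 2 the set below is finite and nonempty, so that its supremum is
   its maximum. *)
Definition spectral_gap P : R :=
  1 - sup [set a | eigenvalue (mx_of P) a /\ a != 1].

Definition relaxation_time P : R := (spectral_gap P)^-1.

End MarkovChain.

Section Network.
Context {R : realType} {V : finType}.
Implicit Types (w : V -> V -> R) (f : {ffun V -> R}).

(* the current induced by the voltage f (Ohm's law) *)
Definition current w f (z u : V) : R := w z u * (f z - f u).

(* The current is a unit flow from x to y (Kirchhoff's node law). *)
Definition unit_voltage w (x y : V) f : Prop :=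
  forall z, \sum_u current w f z u = (z == x)%:R - (z == y)%:R.

(* The voltage drop between x and y when a unit current flows from x to y.
   A unit voltage exists when the network is connected, and the drop does not
   depend on which one is chosen (see eff_resistanceE). *)
Definition eff_resistance w (x y : V) : R :=
  let f := xget [ffun=> 0] [set f | unit_voltage w x y f] in f x - f y.

Lemma unit_voltage_drop w x y f g : (forall z u, w z u = w u z) ->
  unit_voltage w x y f -> unit_voltage w x y g -> f x - f y = g x - g y.
Proof.
move=> wC fP gP.
have dropE h : \sum_z h z * ((z == x)%:R - (z == y)%:R) = h x - h y.
  transitivity (\sum_(z | z == x) h z - \sum_(z | z == y) h z).
    rewrite [X in X - _]big_mkcond [X in _ - X]big_mkcond -sumrB.
    by apply: eq_bigr => z _; case: eqP; case: eqP;
      rewrite mulrBr ?mulr1 ?mulr0.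
  by rewrite !big_pred1_eq.
rewrite -!dropE.
under eq_bigr do rewrite -gP mulr_sumr.
under [RHS]eq_bigr do rewrite -fP mulr_sumr.
have formC (a b : {ffun V -> R}) : \sum_z \sum_u a z * current w b z u =
    \sum_z \sum_u w z u * (a z * b z) - \sum_z \sum_u w z u * (a z * b u).
  rewrite -sumrB; apply: eq_bigr => z _; rewrite -sumrB.
  by apply: eq_bigr => u _; rewrite /current mulrCA -mulrBr -mulrBr.
rewrite !formC; congr (_ - _).
  by apply: eq_bigr => z _; apply: eq_bigr => u _; rewrite [f z * _]mulrC.
rewrite exchange_big; apply: eq_bigr => z _; apply: eq_bigr => u _.
by rewrite wC [f u * _]mulrC.
Qed.

Lemma eff_resistanceE w x y f : (forall z u, w z u = w u z) ->
  unit_voltage w x y f -> eff_resistance w x y = f x - f y.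
Proof.
move=> wC fP; rewrite /eff_resistance; apply: (unit_voltage_drop wC) => //.
exact: (@xgetI _ [ffun=> 0] [set h | unit_voltage w x y h] f fP).
Qed.

End Network.

Definition conductance {R : realType} {V : finType}
    (P : V -> V -> R) (pi : V -> R) (lambda : R) (x y : V) : R :=
  (1 - lambda) * pi x * P x y + lambda * pi x * pi y.

(* the effective resistance R_lambda(x, y) in the network (V, w_lambda) *)
Definition resistance {R : realType} {V : finType}
    (P : V -> V -> R) (pi : V -> R) (lambda : R) (x y : V) : R :=
  eff_resistance (conductance P pi lambda) x y.

(* Main.v *)
Require Import Defs.
From mathcomp Require Import all_boot all_order all_algebra.
From mathcomp Require Import all_classical all_reals.
From mathcomp Require Import complex ring lra.

Set Implicit Arguments.
Unset Strict Implicit.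
Unset Printing Implicit Defensive.

Import Order.TTheory GRing.Theory Num.Theory.
Local Open Scope ring_scope.

(** The proof compares Dirichlet energies.  Let
    D_w(f) = sum_(z, u) w(z, u) (f(z) - f(u))^2.  By the Dirichlet principle,
    an inequality D_w1 <= C D_w0 between energies reverses into the inequality
    R_w0 <= C R_w1 between effective resistances; [eff_resistance_le] gets
    this from the two unit voltages alone, as the positivity of the energy of
    C f1 - f0.  Such voltages exist because the Laplacian, perturbed by the
    all-ones matrix, is injective ([exists_unit_voltage]).

    The energy is affine in the conductances ([dirichlet_conductance]):
    D_lambda = (1 - lambda) D_0 + lambda D_pi, where D_pi is the energy for the
    conductances pi(x) pi(y), that is, twice the variance.  Discarding the
    second term, D_lambda >= (1 - lambda) D_0, which is the upper bound when
    lambda < 1.  For the lower bound, the Poincare inequality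
    gamma D_pi <= D_0 ([poincare]) and lambda <= gamma give
    D_lambda <= D_0 + lambda D_pi <= 2 D_0, so that c = 1/2 works.

    The Poincare inequality is where the spectrum enters.  A real symmetric
    matrix whose eigenvalues are all at most b has its quadratic form bounded
    by b times the square of the norm ([rayleigh_le]), and conjugation by
    sqrt(pi) carries this over to reversible kernels.  Instead of restricting
    the form to functions of mean zero, one applies it to the deflated kernel
    P(x, y) - gamma pi(y): the eigenvalue 1 of the constants is moved to
    1 - gamma, while the others stay where they are, hence at most 1 - gamma
    ([eigenvalue_sub_gap]). *)

(** * Quadratic forms of real symmetric matrices *)

Section Rayleigh.
Local Open Scope sesquilinear_scope.
Local Open Scope complex_scope.

(** Over the complex numbers [S] is unitarily diagonalizable with real
    diagonal entries.  These are eigenvalues of [S] over the base field,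
    because they are roots of a characteristic polynomial that is defined
    there.  In coordinates [w] along the eigenvectors, the form is the sum of
    the [d i] times the squared moduli of the [w i]. *)
Lemma rayleigh_le (R : rcfType) n (S : 'M[R]_n) (b : R) : S^T = S ->
  (forall a, eigenvalue S a -> a <= b) ->
  forall v : 'rV_n, (v *m S *m v^T) 0 0 <= b * (v *m v^T) 0 0.
Proof.
move=> symS eigS v.
pose toC := real_complex R.
pose SC := map_mx toC S; pose U := spectralmx SC; pose d := spectral_diag SC.
have SCherm : SC \is hermsymmx.
  apply: realsym_hermsym.
    apply/is_hermitianmxP; rewrite expr0 scale1r map_mx_id //.
    by rewrite map_trmx symS.
  by apply/mxOverP => i j; rewrite mxE complex_real.
have SCE : SC = invmx U *m diag_mx d *m U.
  by apply/orthomx_spectralP; exact: hermitian_normalmx.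
have Uunit : U \in unitmx by exact: spectral_unit.
have d_le i : d 0 i <= b%:C.
  have /mxOverP/(_ 0 i)/complex_realP[r dr] :=
    hermitian_spectral_diag_real SCherm.
  rewrite -/d in dr.
  rewrite dr lecR; apply: eigS; rewrite eigenvalue_root_char.
  rewrite -(fmorph_root toC) map_char_poly -eigenvalue_root_char -/SC.
  apply/eigenvalueP; exists (row i U).
    rewrite -row_mul SCE !mulmxA mulmxV // mul1mx.
    by rewrite row_mul row_diag_mx -scalemxAl -rowE dr.
  apply: contraTneq Uunit => Ui0; rewrite -row_free_unit -kermx_eq0.
  apply/rowV0Pn; exists (delta_mx 0 i); last first.
    by apply/eqP => /matrixP/(_ 0 i)/eqP; rewrite !mxE !eqxx oner_eq0.
  by apply/sub_kermxP; rewrite -rowE.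
pose w := map_mx toC v *m invmx U.
have wt : U *m (map_mx toC v)^T = w ^t*.
  rewrite /w invmx_unitary ?spectral_unitarymx // trmx_mul map_mxM.
  congr (_ *m _); apply/matrixP => i j; rewrite !mxE.
    exact: esym (conjCK _).
  exact: esym (conjc_real _).
have vvE : map_mx toC v *m (map_mx toC v)^T = w *m w ^t*.
  by rewrite -wt mulmxA mulmxKV.
have vSvE : map_mx toC v *m SC *m (map_mx toC v)^T = w *m diag_mx d *m w ^t*.
  by rewrite -wt SCE !mulmxA.
have toC00 (A : 'M[R]_1) : (A 0 0)%:C = (map_mx toC A) 0 0 by rewrite mxE.
rewrite -lecR rmorphM /= !toC00 !map_mxM -/SC -map_trmx vSvE vvE.
rewrite mul_mx_diag !mxE mulr_sumr; apply: ler_sum => i _.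
rewrite [X in X * _]mxE [_ ^t* i 0]mxE [_^T i 0]mxE.
by rewrite [w 0 i * _]mulrC -mulrA ler_wpM2r // mul_conjC_ge0.
Qed.

End Rayleigh.

Section Networks.
Variables (R : realType) (V : finType).
Implicit Types (P Q w : V -> V -> R) (pi f g h : V -> R).

(** * Dirichlet energy and effective resistance *)

Definition dirichlet w f : R := \sum_z \sum_u w z u * (f z - f u) ^+ 2.

Lemma dirichlet_ge0 w f : (forall z u, 0 <= w z u) -> 0 <= dirichlet w f.
Proof.
by move=> w0; do 2![apply: sumr_ge0 => ? _]; rewrite mulr_ge0 ?sqr_ge0.
Qed.

Lemma dirichlet_lin (a b : R) w w' f :
  dirichlet (fun z u => a * w z u + b * w' z u) f =
  a * dirichlet w f + b * dirichlet w' f.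
Proof.
rewrite /dirichlet !mulr_sumr -big_split; apply: eq_bigr => z _ /=.
rewrite !mulr_sumr -big_split; apply: eq_bigr => u _ /=.
by rewrite mulrDl !mulrA.
Qed.

Lemma dirichlet_expand w f : (forall z u, w z u = w u z) ->
  dirichlet w f = 2 * (\sum_z (\sum_u w z u) * f z ^+ 2
                       - \sum_z \sum_u w z u * f z * f u).
Proof.
move=> wC.
have swap : \sum_z \sum_u w z u * f u ^+ 2 = \sum_z \sum_u w z u * f z ^+ 2.
  rewrite exchange_big; apply: eq_bigr => z _; apply: eq_bigr => u _.
  by rewrite wC.
transitivity (\sum_z \sum_u w z u * f z ^+ 2 + \sum_z \sum_u w z u * f u ^+ 2
     - 2 * \sum_z \sum_u w z u * f z * f u).
  rewrite mulr_sumr -big_split -sumrB; apply: eq_bigr => z _ /=.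
  rewrite mulr_sumr -big_split -sumrB; apply: eq_bigr => u _ /=.
  ring.
under [X in 2 * (X - _)]eq_bigr do rewrite mulr_suml.
rewrite swap; ring.
Qed.

(** The Laplacian f |-> (z |-> sum_u current w f z u) is self-adjoint. *)
Lemma sum_current_sym w (f g : {ffun V -> R}) : (forall z u, w z u = w u z) ->
  \sum_z f z * \sum_u current w g z u = \sum_z g z * \sum_u current w f z u.
Proof.
move=> wC.
have E (a b : {ffun V -> R}) : \sum_z a z * \sum_u current w b z u =
    \sum_z \sum_u w z u * a z * b z - \sum_z \sum_u w z u * a z * b u.
  rewrite -sumrB; apply: eq_bigr => z _; rewrite mulr_sumr -sumrB.
  by apply: eq_bigr => u _; rewrite /current; ring.
rewrite !E; congr (_ - _).
  by apply: eq_bigr => z _; apply: eq_bigr => u _; rewrite mulrAC.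
rewrite exchange_big; apply: eq_bigr => z _; apply: eq_bigr => u _.
by rewrite wC mulrAC.
Qed.

(** The Dirichlet energy counts each unordered edge twice, whence the
    factor 2. *)
Lemma sum_currentE w (f : {ffun V -> R}) : (forall z u, w z u = w u z) ->
  2 * \sum_z f z * \sum_u current w f z u = dirichlet w f.
Proof.
move=> wC; rewrite dirichlet_expand // -sumrB; congr (2 * _).
apply: eq_bigr => z _; rewrite mulr_suml mulr_sumr -sumrB.
by apply: eq_bigr => u _; rewrite /current; ring.
Qed.

(** The divergence of a unit flow from [x] to [y] is the difference of the
    Dirac masses at [x] and [y]. *)
Lemma sum_unit_voltage w x y (f h : {ffun V -> R}) : unit_voltage w x y f ->
  \sum_z h z * \sum_u current w f z u = h x - h y.
Proof.
move=> fP; under eq_bigr do rewrite fP mulrBr.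
have pick a : \sum_z h z * (z == a)%:R = h a.
  rewrite (bigD1 a) //= eqxx mulr1 big1 ?addr0 // => z /negbTE->.
  by rewrite mulr0.
by rewrite sumrB !pick.
Qed.

(** Writing r0 and r1 for the two resistances and B for the energy form of
    [w1], one has B(f1, f1) = r1, B(f0, f1) = r0 and B(f0, f0) <= C r0.  The
    combination C f1 - f0 is the one for which nonnegativity of B yields
    C^2 r1 - 2 C r0 + C r0 >= 0 and no loss in the constant. *)
Lemma eff_resistance_le (w0 w1 : V -> V -> R) C x y (f0 f1 : {ffun V -> R}) :
  (forall z u, w0 z u = w0 u z) -> (forall z u, w1 z u = w1 u z) ->
  (forall z u, 0 <= w1 z u) -> 0 < C ->
  (forall h, dirichlet w1 h <= C * dirichlet w0 h) ->
  unit_voltage w0 x y f0 -> unit_voltage w1 x y f1 ->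
  eff_resistance w0 x y <= C * eff_resistance w1 x y.
Proof.
move=> w0C w1C w1_ge0 C0 le10 f0P f1P.
rewrite (eff_resistanceE w0C f0P) (eff_resistanceE w1C f1P).
pose B (f g : {ffun V -> R}) := \sum_z f z * \sum_u current w1 g z u.
pose h := [ffun z => C * f1 z - f0 z].
have Bh : B h h = C ^+ 2 * B f1 f1 - C * B f0 f1 - C * B f1 f0 + B f0 f0.
  rewrite /B !mulr_sumr -!sumrB -big_split; apply: eq_bigr => z _ /=.
  have -> : \sum_u current w1 h z u =
      C * \sum_u current w1 f1 z u - \sum_u current w1 f0 z u.
    rewrite mulr_sumr -sumrB; apply: eq_bigr => u _.
    by rewrite /current !ffunE; ring.
  by rewrite ffunE; ring.
have Bh_ge0 : 0 <= 2 * B h h by rewrite sum_currentE // dirichlet_ge0.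
have := le10 f0.
rewrite -sum_currentE // -[dirichlet w0 f0]sum_currentE //.
rewrite -/(B f0 f0) (sum_unit_voltage f0 f0P) => Bf0.
move: Bh_ge0; rewrite Bh [B f1 f0]sum_current_sym // -/(B f0 f1).
rewrite /B !(sum_unit_voltage _ f1P) -/(B f0 f0).
move: Bf0; set B0 := B f0 f0; set r0 := f0 x - f0 y; set r1 := f1 x - f1 y.
move=> h1 h2.
have h3 : 0 <= C * (C * r1 - r0) by nra.
by rewrite -subr_ge0 -(pmulr_rge0 _ C0).
Qed.

(** * Kernels as matrices *)

Lemma sum_enum_rank (F : 'I_#|V| -> R) : \sum_i F i = \sum_x F (enum_rank x).
Proof.
by rewrite (reindex (@enum_rank V)) //; exists enum_val => i _;
  rewrite ?enum_rankK ?enum_valK.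
Qed.

Lemma mulmx_mx_of P (v : 'rV[R]_#|V|) y :
  (v *m mx_of P) 0 (enum_rank y) = \sum_x v 0 (enum_rank x) * P x y.
Proof.
rewrite !mxE sum_enum_rank; apply: eq_bigr => x _.
by rewrite !mxE !enum_rankK.
Qed.

(** An injective endomorphism of a finite-dimensional space is surjective. *)
Lemma mx_of_solve (A : V -> V -> R) :
  (forall u : V -> R,
    (forall y, \sum_x u x * A x y = 0) -> forall x, u x = 0) ->
  forall b : V -> R,
    exists u : {ffun V -> R}, forall y, \sum_x u x * A x y = b y.
Proof.
move=> inj b.
have Aunit : mx_of A \in unitmx.
  rewrite -row_free_unit -kermx_eq0; apply/rowV0P => v /sub_kermxP vA0.
  apply/rowP => i; rewrite [RHS]mxE -(enum_valK i).
  apply: (inj (fun x => v 0 (enum_rank x))) => y.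
  by rewrite -mulmx_mx_of vA0 mxE.
pose v := (\row_i b (enum_val i)) *m invmx (mx_of A).
exists [ffun x => v 0 (enum_rank x)] => y.
under eq_bigr do rewrite ffunE.
by rewrite -mulmx_mx_of mulmxKV // mxE enum_rankK.
Qed.

Lemma eigenvalue_mx_ofP P a :
  eigenvalue (mx_of P) a <->
  exists2 u : V -> R,
    (exists x, u x != 0) & forall y, \sum_x u x * P x y = a * u y.
Proof.
split=> [/eigenvalueP[v vP v_neq0]|[u [x ux] uP]].
  exists (fun x => v 0 (enum_rank x)); last first.
    by move=> y; rewrite -mulmx_mx_of vP mxE.
  have /rV0Pn[i vi] := v_neq0.
  by exists (enum_val i); rewrite enum_valK.
apply/eigenvalueP; exists (\row_i u (enum_val i)).
  apply/rowP => i; rewrite -(enum_valK i) mulmx_mx_of !mxE enum_rankK -uP.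
  by apply: eq_bigr => z _; rewrite mxE enum_rankK.
by apply/rV0Pn; exists (enum_rank x); rewrite mxE enum_rankK.
Qed.

(** * Existence of unit voltages *)

(** Let L be the Laplacian and J the all-ones matrix.  The divergence of any
    current sums to zero, so that (L + J) f = b with sum b = 0 forces
    sum f = 0, and then L f = b.  Taking b = 0 shows that L + J is injective,
    since a function of zero energy is constant; taking for b the difference
    of two Dirac masses shows that the preimage of b is a unit voltage. *)
Lemma exists_unit_voltage (w : V -> V -> R) x y :
  (forall z u, w z u = w u z) -> (forall z u, 0 <= w z u) ->
  (forall h : V -> R, dirichlet w h = 0 -> forall z u, h z = h u) ->
  exists f : {ffun V -> R}, unit_voltage w x y f.
Proof.
move=> wC w0 wcon.
(* L + J, with the indices in the order that suits a row vector. *)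
pose A u z : R := 1 + (z == u)%:R * (\sum_t w z t) - w z u.
have AE (f : {ffun V -> R}) z :
    \sum_u f u * A u z = \sum_u f u + \sum_u current w f z u.
  transitivity (\sum_u f u + \sum_u f u * ((z == u)%:R * (\sum_t w z t))
     - \sum_u w z u * f u).
    rewrite -big_split -sumrB; apply: eq_bigr => u _ /=; rewrite /A; ring.
  rewrite -addrA; congr (_ + _).
  have -> : \sum_u f u * ((z == u)%:R * \sum_t w z t) = f z * \sum_t w z t.
    rewrite (bigD1 z) //= eqxx mul1r [X in _ + X]big1 ?addr0 // => u.
    by rewrite eq_sym => /negbTE->; rewrite mul0r mulr0.
  by rewrite mulr_sumr -sumrB; apply: eq_bigr => u _; rewrite /current; ring.
have divE (f : {ffun V -> R}) : \sum_z \sum_u current w f z u = 0.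
  have := sum_current_sym [ffun=> 1] f wC.
  under eq_bigr do rewrite ffunE mul1r.
  move=> ->; apply: big1 => z _; rewrite big1 ?mulr0 // => u _.
  by rewrite /current !ffunE subrr mulr0.
have V0 : (#|V|%:R : R) != 0.
  by rewrite pnatr_eq0 -lt0n; apply/card_gt0P; exists x.
have sumE (f : {ffun V -> R}) (b : V -> R) : \sum_z b z = 0 ->
    (forall z, \sum_u f u * A u z = b z) -> \sum_u f u = 0.
  move=> b0 fb.
  have : \sum_z (\sum_u f u + \sum_u current w f z u) = 0.
    by rewrite -[RHS]b0; apply: eq_bigr => z _; rewrite -AE fb.
  rewrite big_split /= divE addr0 sumr_const -mulr_natl => /eqP.
  by rewrite mulf_eq0 (negbTE V0) => /eqP.
have inj (f : V -> R) :
    (forall z, \sum_u f u * A u z = 0) -> forall z, f z = 0.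
  move=> fA; pose g : {ffun V -> R} := [ffun z => f z].
  have gA z : \sum_u g u * A u z = 0.
    by rewrite -[RHS](fA z); apply: eq_bigr => u _; rewrite ffunE.
  have g0 : \sum_u g u = 0 by apply: (sumE g (fun=> 0)) => //; rewrite big1.
  have D0 : dirichlet w g = 0.
    rewrite -sum_currentE // big1 ?mulr0 // => z _.
    by have := gA z; rewrite AE g0 add0r => ->; rewrite mulr0.
  have cst := wcon g D0.
  move=> z; have : \sum_(u : V) g z = 0.
    by rewrite -[RHS]g0; apply: eq_bigr => u _; exact: cst.
  rewrite sumr_const -mulr_natl => /eqP.
  by rewrite mulf_eq0 (negbTE V0) ffunE => /eqP.
have [f fP] := mx_of_solve inj (fun z => (z == x)%:R - (z == y)%:R).
exists f => z; rewrite -fP AE (sumE f _ _ fP) ?add0r //.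
have one a : \sum_z (z == a)%:R = 1 :> R.
  by rewrite (bigD1 a) //= eqxx big1 ?addr0 // => u /negbTE->.
by rewrite sumrB !one subrr.
Qed.

(** * Irreducible chains *)

Lemma invariant_exp P pi t y : invariant_distribution P pi ->
  \sum_x pi x * (mx_of P ^+ t) (enum_rank x) (enum_rank y) = pi y.
Proof.
case=> _ _ piP.
pose v := \row_i pi (enum_val i) : 'rV[R]_#|V|.
have vP : v *m mx_of P = v.
  apply/rowP => i; rewrite -(enum_valK i) mulmx_mx_of mxE enum_rankK -piP.
  by apply: eq_bigr => x _; rewrite mxE enum_rankK.
have vPt : v *m (mx_of P ^+ t) = v.
  elim: t => [|t IH]; first by rewrite expr0 mulmx1.
  by rewrite exprS -[_ * _]/(_ *m _) mulmxA vP.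
have := congr1 (fun M : 'rV_#|V| => M 0 (enum_rank y)) vPt.
rewrite !mxE enum_rankK sum_enum_rank => <-.
by apply: eq_bigr => x _; rewrite !mxE enum_rankK.
Qed.

Lemma exp_mx_of_ge0 P t i j : (forall x y, 0 <= P x y) ->
  0 <= (mx_of P ^+ t) i j.
Proof.
move=> P0; elim: t i j => [|t IH] i j; first by rewrite expr0 mxE ler0n.
rewrite exprS -[_ * _]/(_ *m _) mxE sumr_ge0 // => k _.
by rewrite mulr_ge0 // mxE.
Qed.

(** Some state has positive mass, and irreducibility spreads it to [x]
    through pi = pi P^t. *)
Lemma invariant_gt0 P pi x : transition_matrix P -> irreducible P ->
  invariant_distribution P pi -> 0 < pi x.
Proof.
move=> [P0 _] Pirr piP; have [pi0 pi1 _] := piP.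
have [z piz] : exists z, 0 < pi z.
  apply/not_existsP => H; move: pi1; rewrite big1 => [/eqP|z _].
    by rewrite eq_sym oner_eq0.
  by apply/eqP; rewrite eq_le pi0 andbT leNgt; apply/negP/H.
have [t Pzx] := Pirr z x.
rewrite -(invariant_exp t x piP) (bigD1 z) //=.
rewrite ltr_pwDl ?mulr_gt0 // sumr_ge0 // => u _.
by rewrite mulr_ge0 // exp_mx_of_ge0.
Qed.

Lemma irreducible_const P (f : V -> R) : irreducible P ->
  (forall x y, P x y != 0 -> f x = f y) -> forall x y, f x = f y.
Proof.
move=> Pirr fP x y.
have H t i j : (mx_of P ^+ t) i j != 0 -> f (enum_val i) = f (enum_val j).
  elim: t i j => [|t IH] i j.
    by rewrite expr0 mxE; case: (i =P j) => [->//|_]; rewrite eqxx.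
  rewrite exprS -[_ * _]/(_ *m _) mxE => S0.
  have [k] : exists k, mx_of P i k * (mx_of P ^+ t) k j != 0.
    apply/not_existsP => H; move/eqP: S0; apply; apply: big1 => k _.
    by apply/eqP/negPn/negP/H.
  rewrite mulf_eq0 negb_or mxE => /andP[Pik Pkj].
  by rewrite (fP _ _ Pik) (IH _ _ Pkj).
have [t Pxy] := Pirr x y.
by have := H t _ _ (lt0r_neq0 Pxy); rewrite !enum_rankK.
Qed.

(** A network that contains all edges of an irreducible chain is connected. *)
Lemma dirichlet_eq0 P (w : V -> V -> R) f : irreducible P ->
  (forall x y, 0 <= w x y) -> (forall x y, P x y != 0 -> w x y != 0) ->
  dirichlet w f = 0 -> forall x y, f x = f y.
Proof.
move=> Pirr w0 Pw Df; apply: (irreducible_const Pirr) => x y /Pw wxy.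
have t0 (z u : V) : 0 <= w z u * (f z - f u) ^+ 2 by rewrite mulr_ge0 ?sqr_ge0.
have /(_ x (erefl _)) :=
  psumr_eq0P (fun z _ => sumr_ge0 _ (fun t _ => t0 z t)) Df.
move=> /(psumr_eq0P (fun t _ => t0 x t))/(_ y (erefl _))/eqP.
by rewrite mulf_eq0 (negbTE wxy) sqrf_eq0 subr_eq0 => /eqP.
Qed.

(** * The Poincare inequality *)

(** Reversibility makes sqrt(pi(x)) Q(x, y) / sqrt(pi(y)) symmetric; being
    conjugate to [Q], it has the same eigenvalues. *)
Lemma rayleigh_reversible_le Q pi b : (forall x, 0 < pi x) -> reversible Q pi ->
  (forall a, eigenvalue (mx_of Q) a -> a <= b) ->
  forall f, \sum_x \sum_y pi x * Q x y * f x * f y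
              <= b * \sum_x pi x * f x ^+ 2.
Proof.
move=> pi_gt0 Qrev eigQ f.
pose s x := Num.sqrt (pi x).
have s_neq0 x : s x != 0 by rewrite gt_eqF // sqrtr_gt0.
have s2 x : pi x = s x ^+ 2 by rewrite sqr_sqrtr // ltW.
pose S := mx_of (fun x y => s x * Q x y / s y).
have Ssym : S^T = S.
  apply/matrixP => i j; rewrite !mxE.
  have := Qrev (enum_val i) (enum_val j); rewrite !s2.
  set x := enum_val i; set y := enum_val j => Qxy.
  apply: (mulIf (s_neq0 x)); apply: (mulIf (s_neq0 y)).
  have sx := s_neq0 x; have sy := s_neq0 y.
  transitivity (s y ^+ 2 * Q y x); first by field.
  by rewrite -Qxy; field.
have eigS a : eigenvalue S a -> a <= b.
  move=> /eigenvalue_mx_ofP[u [x ux] uS]; apply: eigQ.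
  apply/eigenvalue_mx_ofP; exists (fun z => u z * s z).
    by exists x; rewrite mulf_neq0.
  move=> y; rewrite mulrA -uS mulr_suml; apply: eq_bigr => z _.
  by rewrite -!mulrA mulVf // mulr1.
have := rayleigh_le Ssym eigS (\row_i (f (enum_val i) * s (enum_val i))).
rewrite !mxE !sum_enum_rank exchange_big /=.
under eq_bigr do rewrite mulmx_mx_of mulr_suml.
congr (_ <= b * _); last first.
  by apply: eq_bigr => x _; rewrite !mxE !enum_rankK s2; ring.
apply: eq_bigr => y _; apply: eq_bigr => x _.
rewrite !mxE !enum_rankK s2.
by have := s_neq0 y; move=> ?; field.
Qed.

(** Right multiplication by a stochastic matrix does not increase the l^1
    norm of a row vector. *)
Lemma eigenvalue_transition_le1 P a : transition_matrix P ->
  eigenvalue (mx_of P) a -> a <= 1.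
Proof.
move=> [P0 P1] /eigenvalue_mx_ofP[u [x ux] uP].
have norm_gt0 : 0 < \sum_y `|u y|.
  by rewrite (bigD1 x) //= ltr_pwDl ?normr_gt0 // sumr_ge0.
rewrite -(ler_pM2r norm_gt0) mul1r mulr_sumr.
apply: (@le_trans _ _ (\sum_y \sum_z `|u z| * P z y)).
  apply: ler_sum => y _.
  apply: (le_trans (ler_wpM2r (normr_ge0 _) (ler_norm a))).
  rewrite -normrM -uP; apply: (le_trans (ler_norm_sum _ _ _)).
  by apply: ler_sum => z _; rewrite normrM (ger0_norm (P0 _ _)).
rewrite exchange_big; apply: ler_sum => z _.
by rewrite -mulr_sumr P1 mulr1.
Qed.

(** Summing the eigenvector equation over all states gives
    (1 - gamma) sum u = a sum u.  Hence either a = 1 - gamma, or sum u = 0 and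
    [u] is a left eigenvector of [P] itself.  In the second case a <> 1: the
    density u / pi of an invariant [u] has zero energy, so it is constant,
    and sum u = 0 makes it vanish. *)
Lemma eigenvalue_sub_gap P pi a : transition_matrix P -> irreducible P ->
  invariant_distribution P pi -> reversible P pi ->
  let gap := spectral_gap P in
  eigenvalue (mx_of (fun x y => P x y - gap * pi y)) a -> a <= 1 - gap.
Proof.
move=> Ptr Pirr piP Prev gap /eigenvalue_mx_ofP[u [x0 ux0] uQ].
have [P0 P1] := Ptr; have [_ pi1 piPE] := piP.
have uP y : \sum_x u x * P x y = a * u y + gap * (\sum_x u x) * pi y.
  rewrite -uQ -mulrA mulr_suml mulr_sumr -big_split.
  by apply: eq_bigr => x _ /=; ring.
have : \sum_x u x = a * \sum_x u x + gap * \sum_x u x.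
  transitivity (\sum_y \sum_x u x * P x y).
    by rewrite exchange_big; apply: eq_bigr => x _; rewrite -mulr_sumr P1 mulr1.
  under eq_bigr do rewrite uP.
  by rewrite big_split /= -!mulr_sumr pi1 mulr1.
have [u0 _|un0 uE] := eqVneq (\sum_x u x) 0; last first.
  suff -> : a = 1 - gap by [].
  by apply: (mulIf un0); rewrite mulrBl mul1r {2}uE addrK.
have {}uP y : \sum_x u x * P x y = a * u y by rewrite uP u0 mulr0 mul0r addr0.
have ea : eigenvalue (mx_of P) a.
  by apply/eigenvalue_mx_ofP; exists u => //; exists x0.
have a1 : a != 1.
  apply: contra_neq ux0 => a1.
  have pi_gt0 x : 0 < pi x by apply: (invariant_gt0 x Ptr Pirr piP).
  pose f x := u x / pi x.
  have uf x : u x = pi x * f x by rewrite mulrC divfK // gt_eqF.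
  have w0 x y : 0 <= pi x * P x y by rewrite mulr_ge0 // ltW.
  have D0 : dirichlet (fun x y => pi x * P x y) f = 0.
    rewrite dirichlet_expand // [X in X - _](_ : _ = \sum_y f y * u y).
      rewrite exchange_big -sumrB big1 ?mulr0 // => y _ /=.
      apply/eqP; rewrite subr_eq0 -[u y]mul1r -a1 -uP mulr_sumr.
      by apply/eqP/eq_bigr => x _; rewrite uf; ring.
    by apply: eq_bigr => x _; rewrite -mulr_sumr P1 uf; ring.
  have fc : forall x y, f x = f y.
    apply: (dirichlet_eq0 Pirr w0 _ D0) => x y Pxy.
    by rewrite mulf_neq0 // gt_eqF.
  have : f x0 = \sum_x u x.
    rewrite -[LHS]mul1r -pi1 mulr_suml; apply: eq_bigr => x _.
    by rewrite uf (fc x x0).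
  by rewrite u0 uf => ->; rewrite mulr0.
rewrite /gap /spectral_gap subKr; apply: ub_le_sup; last by split.
by exists 1 => b [eb _]; exact: eigenvalue_transition_le1 eb.
Qed.

(** The difference of the two sides is the energy for the signed conductances
    pi(x) Q(x, y), Q being the deflated kernel.  As the rows of [Q] sum to
    1 - gamma, its nonnegativity says that the quadratic form of [Q] is at
    most 1 - gamma times the square of the norm. *)
Lemma poincare P pi f : transition_matrix P -> irreducible P ->
  invariant_distribution P pi -> reversible P pi ->
  spectral_gap P * dirichlet (fun x y => pi x * pi y) f <=
  dirichlet (fun x y => pi x * P x y) f.
Proof.
move=> Ptr Pirr piP Prev; have [P0 P1] := Ptr; have [_ pi1 piPE] := piP.
set gap := spectral_gap P.
pose Q x y := P x y - gap * pi y.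
have Qrev : reversible Q pi.
  by move=> x y; rewrite !mulrBr Prev; congr (_ - _); ring.
have ray := rayleigh_reversible_le (fun x => invariant_gt0 x Ptr Pirr piP) Qrev
  (fun a => eigenvalue_sub_gap Ptr Pirr piP Prev) f.
rewrite -subr_ge0 -[X in X - _]mul1r -mulNr -dirichlet_lin.
have -> : dirichlet (fun x y => 1 * (pi x * P x y) + - gap * (pi x * pi y)) f =
    dirichlet (fun x y => pi x * Q x y) f.
  by apply: eq_bigr => x _; apply: eq_bigr => y _; rewrite /Q; ring.
rewrite dirichlet_expand // mulr_ge0 ?subr_ge0 //.
apply: (le_trans ray); rewrite mulr_sumr le_eqVlt; apply/orP; left; apply/eqP.
apply: eq_bigr => x _.
by rewrite -mulr_sumr sumrB P1 -mulr_sumr pi1 mulr1 -/gap; ring.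
Qed.

(** * Comparison of resistances *)

Lemma dirichlet_conductance P pi lambda f :
  dirichlet (conductance P pi lambda) f =
  (1 - lambda) * dirichlet (fun x y => pi x * P x y) f
  + lambda * dirichlet (fun x y => pi x * pi y) f.
Proof.
rewrite -dirichlet_lin; apply: eq_bigr => x _; apply: eq_bigr => y _.
by rewrite /conductance; ring.
Qed.

End Networks.

Theorem theorem5p2 (R : realType) :
  exists2 c : R, 0 < c &
    forall (V : finType) (P : V -> V -> R) (pi : V -> R),
      transition_matrix P -> irreducible P ->
      invariant_distribution P pi -> reversible P pi ->
      forall lambda : R, 0 <= lambda <= 1 ->
        lambda <= (relaxation_time P)^-1 ->
      forall x y : V, x != y ->
        c * resistance P pi 0 x y <= resistance P pi lambda x y /\
        ((resistance P pi lambda x y)%:E <=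
          (if lambda == 1%R then +oo
           else ((1 - lambda)^-1 * resistance P pi 0 x y)%R%:E))%E.
Proof.
exists 2^-1; first by rewrite invr_gt0.
move=> V P pi Ptr Pirr piP Prev lambda /andP[lam0 lam1].
rewrite invrK => lam_gap x y _.
have [P0 P1] := Ptr.
have pi_gt0 z : 0 < pi z by exact: invariant_gt0 Ptr Pirr piP.
have pi_ge0 z : 0 <= pi z by exact: ltW.
have sym l z u : conductance P pi l z u = conductance P pi l u z.
  by rewrite /conductance -!mulrA Prev [pi z * pi u]mulrC.
have ge0 l z u : 0 <= l <= 1 -> 0 <= conductance P pi l z u.
  by move=> /andP[l0 l1]; rewrite addr_ge0 ?mulr_ge0 ?subr_ge0.
have D0_ge0 h : 0 <= dirichlet (fun z u => pi z * P z u) h.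
  by apply: dirichlet_ge0 => z u; rewrite mulr_ge0.
have Dpi_ge0 h : 0 <= dirichlet (fun z u => pi z * pi u) h.
  by apply: dirichlet_ge0 => z u; rewrite mulr_ge0.
have DE := dirichlet_conductance P pi.
have volt l : 0 <= l <= 1 -> exists f, unit_voltage (conductance P pi l) x y f.
  move=> l01; apply: exists_unit_voltage => [z u|z u|h Dh].
  - exact: sym.
  - exact: ge0.
  apply: (dirichlet_eq0 Pirr _ _ Dh) => [z u|z u Pzu]; first exact: ge0.
  (* For l = 1 only the term pi(z) pi(u) survives, and for l = 0 only
     pi(z) P(z, u). *)
  case/andP: l01 => l0 l1; rewrite gt_eqF // /conductance.
  have Pzu0 : 0 < P z u by rewrite lt_def Pzu P0.
  have [->|l_neq0] := eqVneq l 0.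
    by rewrite subr0 mul1r !mul0r addr0 mulr_gt0.
  have l_gt0 : 0 < l by rewrite lt_def l_neq0.
  by rewrite ltr_wpDl ?mulr_gt0 // !mulr_ge0 ?subr_ge0.
have zero01 : 0 <= (0 : R) <= 1 by rewrite lexx ler01.
have lam01 : 0 <= lambda <= 1 by rewrite lam0.
have [f0 f0P] := volt 0 zero01.
have [f1 f1P] := volt lambda lam01.
split.
  rewrite ler_pdivrMl //.
  apply: (eff_resistance_le _ _ _ _ _ f0P f1P) => //.
    by move=> z u; exact: ge0.
  move=> h; have := poincare h Ptr Pirr piP Prev.
  rewrite !DE; have := D0_ge0 h; have := Dpi_ge0 h.
  set D0 := dirichlet (fun z u => pi z * P z u) h.
  set Dpi := dirichlet (fun z u => pi z * pi u) h.
  move: lam_gap; set gap := spectral_gap P => lam_gap Dpi0 D00 gapD.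
  have : lambda * Dpi <= D0 by apply: le_trans gapD; rewrite ler_wpM2r.
  (* The energy of [h] is at most D0 + lambda Dpi, which is at most 2 D0. *)
  have : 0 <= lambda * D0 by rewrite mulr_ge0.
  lra.
case: eqVneq => [_|lam_neq1]; first by rewrite leey.
have lam_lt1 : 0 < 1 - lambda by rewrite subr_gt0 lt_neqAle lam_neq1.
rewrite lee_fin.
apply: (eff_resistance_le _ _ _ _ _ f1P f0P) => //.
- by move=> z u; exact: ge0.
- by rewrite invr_gt0.
move=> h; rewrite !DE ler_pdivlMl // subr0 mul1r mul0r addr0.
by rewrite lerDl mulr_ge0.
Qed.
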